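(* For every odd $t\geqslant5$ we have $$m_t\geqslant\frac{L_t+1}{2}t+L_t^2+L_t+1\ \sim\ \frac{t^2}{4},$$ $$\tau_t\geqslant N_t+2\ \sim\ t\sqrt5,$$ where $\sim$ denotes asymptotic equivalence of the lower bounds as $t\to\infty$.
   Context: Normal form orbit of order $t$ ($t\geqslant5$ odd): set $\gamma_{t-1}:=[0,1]$, $\mathcal{M}_{t-2}:=0$, $\mathcal{M}_{t-1}:=\frac12$, and for every $n\geqslant t$ let $y_n=n\mathcal{M}_{n-1}-(n-1)\mathcal{M}_{n-2}$, $\gamma_n=\gamma_{n-1}\uplus[y_n]$ (multiset union), and $\mathcal{M}_n:=\mathcal{M}(\gamma_n)$, the median of $\gamma_n$ (the average of the two central elements if $|\gamma_n|$ is even). The median sequence is non-decreasing. $m_t$ is the limit of the normal form of order $t$, i.e. the limit of the orbit $(y_n)$, which is the limit of the median sequence $(\mathcal{M}_n)$ (regarded as an element of $(-\infty,+\infty]$). $\tau_t$ is its transit time: the least integer $\tau$ with $y_{\tau+k}=y_\tau$ for all $k\in\mathbb{N}$, and $\tau_t=\infty$ if there is none. With $u_\ell:=\ell+1+\sqrt{5\ell^2+6\ell+5}$ for $\ell\in\mathbb{N}_0$ (an increasing sequence), define $$L_t:=\max\{\ell\in\mathbb{N}_0:t>u_\ell\}=\left\lceil\frac{-t-2+\sqrt{5t^2-4t-12}}{4}\right\rceil-1,\qquad N_t:=t+4L_t+3.$$ *)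

(* Defs.v *)
From HB Require Import structures.
From mathcomp Require Import all_boot all_order all_algebra.
From mathcomp Require Import all_classical all_reals all_analysis.
From mathcomp Require Import lra.

Set Implicit Arguments.
Unset Strict Implicit.
Unset Printing Implicit Defensive.
Import Order.TTheory GRing.Theory Num.Theory numFieldNormedType.Exports.
Local Open Scope classical_set_scope.
Local Open Scope ring_scope.

Section MedianMap.
Variable R : realType.
Implicit Types (s : seq R) (t n l k : nat).

(* A finite multiset of reals is represented by any sequence enumerating it. *)
Definition median s : R :=
  let s' := sort <=%R s in
  let h := (size s)./2 in
  if odd (size s) then s'`_h else (s'`_h.-1 + s'`_h) / 2.

Lemma perm_median s1 s2 : perm_eq s1 s2 -> median s1 = median s2.
Proof.
move=> s12; rewrite /median (perm_size s12).
by have /perm_sort_leP -> : perm_eq s1 s2 by [].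
Qed.

(* The pair (gamma_{t-1+k}, M_{t-2+k}).  The value M_{t-1} = 1/2 is not
   prescribed separately, being the median of gamma_{t-1} = [0, 1]. *)
Fixpoint nf_state t k : seq R * R :=
  if k is k'.+1 then
    let: (g, m') := nf_state t k' in
    let m := median g in
    ((t + k')%:R * m - (t + k').-1%:R * m' :: g, m)
  else ([:: 0; 1], 0).

(* gamma_n for n >= t-1, M_n for n >= t-2 and y_n for n >= t; the values at
   smaller indices are junk (0 for nf_median). *)
Definition nf_gamma t n : seq R := (nf_state t (n.+1 - t)).1.
Definition nf_median t n : R := (nf_state t (n.+2 - t)).2.
Definition nf_orbit t n : R :=
  n%:R * nf_median t n.-1 - n.-1%:R * nf_median t n.-2.

Lemma nf_gamma0 t : (0 < t)%N -> nf_gamma t t.-1 = [:: 0; 1].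
Proof. by move=> t0; rewrite /nf_gamma prednK // subnn. Qed.

Lemma nf_median0 t : (1 < t)%N -> nf_median t t.-2 = 0.
Proof. by case: t => [|[|t]] // _; rewrite /nf_median /= subnn. Qed.

Lemma nf_median1 t : (1 < t)%N -> nf_median t t.-1 = 2^-1.
Proof.
case: t => [|[|t]] // _; rewrite /nf_median /= subSnn /=.
have -> : median [:: 0; 1] = (0 + 1) / 2.
  by rewrite /median sorted_sort //= ?ler01 //; exact: le_trans.
by rewrite add0r div1r.
Qed.

Lemma nf_medianE t n : (0 < t)%N -> (t <= n.+1)%N ->
  nf_median t n = median (nf_gamma t n).
Proof.
move=> t0 tn; rewrite /nf_median /nf_gamma subSn //=.
by case: (nf_state _ _).
Qed.

Lemma nf_gammaS t n : (1 < t)%N -> (t <= n)%N ->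
  nf_gamma t n = nf_orbit t n :: nf_gamma t n.-1.
Proof.
case: t => [|[|t]] // _; case: n => [|[|n]] //; rewrite !ltnS => tn.
have e3 : (n.+3 - t.+2 = (n - t).+1)%N by rewrite !subSS subSn.
rewrite /nf_orbit nf_medianE //= /nf_gamma /nf_median e3 !subSS /= !addSn subnKC //.
by case: (nf_state _ _).
Qed.

(* m_t, as an element of the extended real line: the limit of the median
   sequence, which exists because that sequence is non-decreasing.  By
   cvg_orbit_limit, it is also the limit of the orbit whenever the latter has
   one. *)
Definition nf_limit t : \bar R := limn (fun n => (nf_median t n)%:E).

Lemma nf_median_mean t :
  nf_median t = arithmetic_mean (fun n => nf_orbit t n.+1).
Proof.
rewrite funeqE => n; rewrite /arithmetic_mean /series /nf_orbit /=.
rewrite (telescope_sumr (fun k => k%:R * nf_median t k.-1)) //=.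
by rewrite mul0r subr0 mulKf.
Qed.

Lemma cvg_orbit_limit t (l : \bar R) :
  (l != -oo)%E -> (fun n => (nf_orbit t n)%:E) @ \oo --> l -> nf_limit t = l.
Proof.
move=> lNoo yl; apply/cvg_lim => //.
have {}yl : (fun n => (nf_orbit t n.+1)%:E) @ \oo --> l.
  by rewrite (cvg_shiftS (fun n => (nf_orbit t n)%:E)).
rewrite nf_median_mean; case: l lNoo yl => [l||] // _ yl.
  apply: cvg_EFin; first exact: nearW.
  by apply: cesaro; exact: (fine_cvg yl).
apply/cvgeyPge => A.
pose v n : R := Num.min (nf_orbit t n.+1) (A + 1).
have /cesaro vA : v @ \oo --> A + 1.
  apply: cvg_near_cst; move/cvgeyPge : yl => /(_ (A + 1)); apply: filterS => n.
  by rewrite lee_fin /v => /min_idPr.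
near=> n; rewrite lee_fin (@le_trans _ _ (arithmetic_mean v n)) //.
  near: n; apply: (cvgr_ge (A + 1)) => //; lra.
rewrite /arithmetic_mean ler_pM2l ?invr_gt0// /series /= ler_sum// => k _.
by rewrite /v ge_min lexx.
Unshelve. all: by end_near. Qed.

(* tau_t; orbits are indexed by n >= t, and +oo means that there is no such
   index. *)
Definition stable_from t n : bool :=
  `[< (t <= n)%N /\ forall k, nf_orbit t (n + k) = nf_orbit t n >].

Definition transit_time t : \bar R :=
  match pselect (exists n, stable_from t n) with
  | left ex => (ex_minn ex)%:R%:E
  | right _ => +oo%E
  end.

Definition u_ l : R := l.+1%:R + Num.sqrt (5 * l%:R ^+ 2 + 6 * l%:R + 5).

(* The range l < t is no restriction since l < u_ l; cf. L_max below. *)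
Definition L_ t : nat := \max_(l < t | u_ l < t%:R) l.

Definition N_ t : nat := (t + 4 * L_ t + 3)%N.

Lemma lt_u_ l : l%:R < u_ l.
Proof. by rewrite /u_ -addn1 natrD -addrA ltrDl ltr_pwDl ?sqrtr_ge0. Qed.

Lemma L_max t : (5 <= t)%N ->
  u_ (L_ t) < t%:R /\ forall l, u_ l < t%:R -> (l <= L_ t)%N.
Proof.
move=> t5; split; last first.
  move=> l ult; have lt_lt : (l < t)%N.
    by rewrite -(ltr_nat R) (lt_trans (lt_u_ l)).
  exact: (@leq_bigmax_cond _ _ _ (Ordinal lt_lt)).
have u0 : u_ 0 < t%:R.
  rewrite /u_ expr0n /= !mulr0 !add0r.
  have s3 : Num.sqrt 5 < 3 :> R.
    rewrite -[ltRHS](@gtr0_norm R 3) // -sqrtr_sqr ltr_sqrt -?natrX ?ltr_nat //.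
  have : 5 <= t%:R :> R by rewrite (ler_nat R 5 t).
  lra.
rewrite /L_; apply: (big_ind (fun m => u_ m < t%:R)) => // m n um un.
by rewrite /maxn; case: ifP.
Qed.

Definition limit_bound t : R :=
  ((L_ t)%:R + 1) / 2 * t%:R + (L_ t)%:R ^+ 2 + (L_ t)%:R + 1.

Definition transit_bound t : R := (N_ t)%:R + 2.

End MedianMap.

(* Main.v *)
Require Import Defs.
From mathcomp Require Import all_boot all_order all_algebra.
From mathcomp Require Import all_classical all_reals all_analysis.
From mathcomp Require Import zify ring lra.

(** Up to index [N_t] the orbit can be computed in closed form.  Put
    [a_j = j t / 2 + j (j - 1)] (here [rung t j]).  The multiset starts as
    [a_0, a_0 + 1 = 0, 1] and grows in blocks of four.  Suppose that at the
    start of block [j] the two central elements are [a_j] and [a_j + 1], and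
    that the last two medians are [a_j] and [a_j + 1 / 2].  With [n = t + 4 j],
    the recursion gives [y_n = a_j + n / 2 = a_(j+1)] and
    [y_(n+1) = a_(j+1) + 1]; then the median jumps from [a_j + 1] towards
    [a_(j+1)], and this jump throws [y_(n+2)] and [y_(n+3)] up to at least
    [t ^ 2 / 4].  So two elements enter just above the centre and two enter far
    above it.  As long as [a_(j+1) + 1 <= t ^ 2 / 4] the far elements stay above
    the centre, which therefore moves to [a_(j+1), a_(j+1) + 1]: the picture
    reproduces itself ([in_phase_next]).

    Solving the quadratic inequality [a_(l+1) + 1 < t ^ 2 / 4] in [t] gives
    exactly [u_l < t] ([u_lt]), so the phase covers all the blocks up to [L_t]
    and ends at [N_t].  One more step is still forced ([in_phase_start]): the
    median at [N_t + 1] is [a_(L+1) + 1], the claimed bound on [m_t], because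
    the medians are non-decreasing ([nf_median_nondecreasing]).  Moreover
    [y_(N_t + 2) = y_(N_t + 1) + 1], so the orbit is not constant from any index
    below [N_t + 2].

    For the asymptotics, the maximality of [L_t] encloses [t ^ 2 / 4] between
    two consecutive values of [a_j + 1], whose distance is [O(t)].  This is the
    first equivalence; completing the square turns the same two inequalities
    into [5 t ^ 2 - (t + 4 L_t) ^ 2 = O(t)], which is the second. *)

Set Implicit Arguments.
Unset Strict Implicit.
Unset Printing Implicit Defensive.
Import Order.TTheory GRing.Theory Num.Theory numFieldNormedType.Exports.
Local Open Scope classical_set_scope.
Local Open Scope ring_scope.

(** * Medians of multisets presented by their central elements *)

Section Median.
Variable R : realType.
Implicit Types (s lo hi : seq R) (x y : R).

Lemma sort_pivot s lo hi x : perm_eq s (lo ++ x :: hi) ->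
  all (<= x) lo -> all (>= x) hi ->
  sort <=%R s = sort <=%R lo ++ x :: sort <=%R hi.
Proof.
move=> sE lox xhi; apply: (sorted_eq le_trans le_anti).
- exact: (sort_sorted le_total).
- have loS a : a \in sort <=%R lo -> a <= x.
    by rewrite mem_sort => /(allP lox).
  have hiS b : b \in sort <=%R hi -> x <= b.
    by rewrite mem_sort => /(allP xhi).
  rewrite (sorted_pairwise le_trans) pairwise_cat /=.
  rewrite -!(sorted_pairwise le_trans) !(sort_sorted le_total) !andbT.
  apply/andP; split; last exact/allP.
  apply/allrelP => a b /loS ax; rewrite inE => /predU1P[->//|/hiS].
  exact: le_trans.
- by rewrite perm_sort (permPl sE) perm_sym perm_cat ?perm_cons ?perm_sort.
Qed.

Lemma median_odd s lo hi x : perm_eq s (lo ++ x :: hi) ->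
  all (<= x) lo -> all (>= x) hi -> size lo = size hi -> median s = x.
Proof.
move=> sE lox xhi lohi; rewrite /median (sort_pivot sE)// (perm_size sE).
rewrite size_cat /= lohi addnS addnn /= odd_double /= uphalf_double.
by rewrite nth_cat size_sort lohi ltnn subnn.
Qed.

Lemma median_even s lo hi x y : perm_eq s (lo ++ x :: y :: hi) ->
  all (<= x) lo -> x <= y -> all (>= y) hi -> size lo = size hi ->
  median s = (x + y) / 2.
Proof.
move=> sE lox xy yhi lohi.
have yhi' : all (>= x) (y :: hi).
  by rewrite /= xy; apply: sub_all yhi => z; exact: le_trans.
have sortyhi : sort <=%R (y :: hi) = y :: sort <=%R hi.
  by rewrite (@sort_pivot _ [::] hi y).
rewrite /median (sort_pivot sE)// sortyhi (perm_size sE).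
rewrite size_cat /= lohi !addnS addnn /= odd_double /= doubleK.
by rewrite !nth_cat size_sort lohi ltnn ltnNge leqnSn subnn subSnn.
Qed.

Lemma perm_insert s lo hi y :
  perm_eq s (lo ++ hi) -> perm_eq (y :: s) (lo ++ y :: hi).
Proof.
move=> sE; rewrite -cat1s -(cat1s y hi) perm_sym perm_catCA perm_cat2l.
by rewrite perm_sym.
Qed.

Lemma odd_split s : odd (size s) -> exists lo x hi,
  [/\ perm_eq s (lo ++ x :: hi), all (<= x) lo, all (>= x) hi &
      size lo = size hi].
Proof.
move=> os; pose s' := sort <=%R s; pose h := (size s)./2.
have sz : size s' = h.*2.+1 by rewrite size_sort -(odd_double_half (size s)) os.
have hs : (h < size s')%N by rewrite sz; lia.
have s'E : s' = take h s' ++ s'`_h :: drop h.+1 s'.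
  by rewrite -drop_nth// cat_take_drop.
have: pairwise <=%R s'.
  by rewrite -(sorted_pairwise le_trans) (sort_sorted le_total).
rewrite {1}s'E pairwise_cat /= allrel_consr => /and3P[/andP[lox _] _].
move=> /andP[xhi _].
exists (take h s'), s'`_h, (drop h.+1 s'); split => //.
  by rewrite -s'E perm_sym perm_sort.
by rewrite size_drop size_takel sz; lia.
Qed.

Lemma even_split s : ~~ odd (size s) -> (0 < size s)%N -> exists lo x y hi,
  [/\ perm_eq s (lo ++ x :: y :: hi), all (<= x) lo, x <= y, all (>= y) hi &
      size lo = size hi].
Proof.
move=> os s0; pose s' := sort <=%R s; pose h := (size s)./2.-1.
have sz : size s' = h.+1.*2.
  rewrite size_sort -(odd_double_half (size s)) (negbTE os) /h.
  by move: s0 os; case: (size s) => [|[|n]].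
have s'E : s' = take h s' ++ s'`_h :: s'`_h.+1 :: drop h.+2 s'.
  by rewrite -!drop_nth ?cat_take_drop// sz; lia.
have: pairwise <=%R s'.
  by rewrite -(sorted_pairwise le_trans) (sort_sorted le_total).
rewrite {1}s'E pairwise_cat /= allrel_consr.
move=> /and3P[/andP[lox _] _ /andP[/andP[xy _] /andP[yhi _]]].
exists (take h s'), s'`_h, s'`_h.+1, (drop h.+2 s'); split => //.
  by rewrite -s'E perm_sym perm_sort.
by rewrite size_drop size_takel sz; lia.
Qed.

(** With an odd number of elements the old median becomes the lower of the two
    central elements; with an even number the new median is the smaller of the
    new element and the upper central element. *)
Lemma median_cons_ge s y : (0 < size s)%N ->
  median s <= y -> median s <= median (y :: s).
Proof.
move=> s0; case: (boolP (odd (size s))) => os.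
  have [lo [x [hi [sE lox xhi lohi]]]] := odd_split os.
  rewrite (median_odd sE)// => xy.
  case E : (sort <=%R (y :: hi)) => [|z hi'].
    by move: (congr1 size E); rewrite size_sort.
  have zhi : perm_eq (y :: hi) (z :: hi') by rewrite -E perm_sym perm_sort.
  have : path <=%R z hi' by have := sort_sorted le_total (y :: hi); rewrite E.
  rewrite (path_sortedE le_trans) => /andP[zhi' _].
  have xz : x <= z.
    have : all (>= x) (y :: hi) by rewrite /= xy.
    by rewrite (perm_all _ zhi) /= => /andP[].
  rewrite (@median_even _ lo hi' x z) //; first by lra.
    rewrite -cat_rcons.
    apply: perm_trans (_ : perm_eq _ (rcons lo x ++ y :: hi)) _.
      by apply: perm_insert; rewrite cat_rcons.
    by rewrite perm_cat2l.
  by move: (perm_size zhi) => /= [<-].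
have [lo [p [q [hi [sE lop pq qhi lohi]]]]] := even_split os s0.
rewrite (median_even sE)// => py.
have py' : p <= y by lra.
have lop' : all (<= p) (rcons lo p) by rewrite all_rcons /= lexx.
have [yq|qy] := leP y q.
  rewrite (@median_odd _ (rcons lo p) (q :: hi) y) //.
  - by apply: perm_insert; rewrite cat_rcons.
  - by apply: sub_all lop' => z /le_trans; exact.
  - by rewrite /= yq; apply: sub_all qhi => z; exact: le_trans.
  - by rewrite size_rcons lohi.
rewrite (@median_odd _ (rcons lo p) (y :: hi) q) //; first by lra.
- by rewrite -cat_rcons; apply: perm_insert; rewrite !cat_rcons.
- by apply: sub_all lop' => z /le_trans; exact.
- by rewrite /= (ltW qy).
- by rewrite size_rcons lohi.
Qed.

End Median.

(** * The median sequence is non-decreasing *)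

Section Monotone.
Variable R : realType.

Lemma size_nf_gamma t n : size (nf_gamma R t n) = (n.+1 - t).+2.
Proof.
rewrite /nf_gamma; elim: (n.+1 - t)%N => //= k.
by case: (nf_state _ _) => g m /= ->.
Qed.

(** The orbit is defined so that [y_n] exceeds [M_(n-1)] by [n - 1] times the
    last increment of the median, so an increase propagates. *)
Lemma nf_median_nondecreasing t : (1 < t)%N ->
  nondecreasing_seq (nf_median R t).
Proof.
move=> t1; apply/nondecreasing_seqP => n.
have [nt|tn] := ltnP n t.-2.
  have e0 : (n.+2 - t = 0)%N by lia.
  have e1 : (n.+3 - t = 0)%N by lia.
  by rewrite /nf_median e0 e1.
rewrite -(subnKC tn); elim: (n - t.-2)%N => [|k IH].
  have -> : (t.-2 + 0).+1 = t.-1 by lia.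
  by rewrite addn0 nf_median0 // nf_median1 // invr_ge0.
rewrite addnS; set m := (t.-2 + k)%N in IH *.
have mE : nf_median R t m.+1 = median (nf_gamma R t m.+1).
  by apply: nf_medianE; lia.
have -> : nf_median R t m.+2 = median (nf_gamma R t m.+2).
  by apply: nf_medianE; lia.
have -> : nf_gamma R t m.+2 = nf_orbit R t m.+2 :: nf_gamma R t m.+1.
  by apply: nf_gammaS; lia.
rewrite mE; apply: median_cons_ge; first by rewrite size_nf_gamma.
have -> : nf_orbit R t m.+2 =
    m.+2%:R * nf_median R t m.+1 - m.+1%:R * nf_median R t m by [].
rewrite -mE.
rewrite -[m.+2]addn1 natrD mulrDl mul1r -addrAC lerDr -mulrBr.
by rewrite mulr_ge0 ?subr_ge0.
Qed.

End Monotone.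

(** * The regular phase of the orbit *)

Section Regular.
Variable R : realType.
Implicit Types (t n j : nat) (lo hi : seq R).

(** The lower of the two central elements [a, a + 1] at the start of block
    [j]. *)
Definition rung t j : R := j%:R / 2 * t%:R + j%:R * (j%:R - 1).

Lemma rungS t j : rung t j.+1 = rung t j + (t + 4 * j)%:R / 2.
Proof. by rewrite /rung -natr1 natrD natrM; field. Qed.

Lemma rung_nondecreasing t : nondecreasing_seq (rung t).
Proof.
apply/nondecreasing_seqP => j.
by rewrite rungS lerDl divr_ge0.
Qed.

Lemma rung_ge0 t j : 0 <= rung t j.
Proof.
have := @rung_nondecreasing t 0 j (leq0n j).
by rewrite [rung t 0]/rung !mul0r addr0.
Qed.

(** The state between two blocks; [n + 2] is the index of the next element.
    The threshold [B] separates the far elements from the centre, and [lo] and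
    [hi] having the same size makes [a] and [a + 1] the central elements. *)
Definition in_phase t n a B : Prop :=
  [/\ nf_median R t n = a, nf_median R t n.+1 = a + 1 / 2 &
    exists lo hi, [/\ perm_eq (nf_gamma R t n.+1) (lo ++ a :: a + 1 :: hi),
      all (<= a) lo, all (>= B) hi & size lo = size hi]].

Lemma nf_orbitSS t n : nf_orbit R t n.+2 =
  n.+2%:R * nf_median R t n.+1 - n.+1%:R * nf_median R t n.
Proof. by []. Qed.

(** The first two elements of a block are determined by the old centre and the
    far elements only have to lie above [a + 1], so this applies both inside
    the regular phase and just after its end. *)
Lemma in_phase_start t n a B : (1 < t)%N -> (t <= n.+2)%N ->
  in_phase t n a B -> a + 1 <= B ->
  [/\ nf_orbit R t n.+2 = a + n.+2%:R / 2,
      nf_median R t n.+2 = a + 1 &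
      nf_orbit R t n.+3 = a + n.+2%:R / 2 + 1].
Proof.
move=> t1 tn [Mn Mn1 [lo [hi [gE loa hiB lohi]]]] aB.
have yn : nf_orbit R t n.+2 = a + n.+2%:R / 2.
  by rewrite nf_orbitSS Mn Mn1 -[n.+2%:R]natr1; field.
have Mn2 : nf_median R t n.+2 = a + 1.
  rewrite (nf_medianE R (ltnW t1) (leqW tn)) (nf_gammaS R t1 tn).
  rewrite yn (@median_odd _ _ (rcons lo a) (a + n.+2%:R / 2 :: hi) (a + 1)) //.
  - rewrite -cat_rcons; apply: perm_insert.
    by rewrite !cat_rcons.
  - rewrite all_rcons /= lerDl ler01 /=.
    by apply: sub_all loa => z /= za; rewrite ler_wpDr.
  - rewrite /=; apply/andP; split.
      by rewrite lerD2l ler_pdivlMr // mul1r ler_nat.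
    by apply: sub_all hiB => z; exact: le_trans.
  - by rewrite size_rcons lohi.
split=> //; by rewrite nf_orbitSS Mn2 Mn1 -[n.+3%:R]natr1; field.
Qed.

(** Writing [N = n + 2] and [c = a + N / 2], the median grows by
    [(c - a - 1) / 2 = (N - 2) / 4] twice, hence the third element is
    [a + 1 + (N + 2) (N - 2) / 4 = a + N ^ 2 / 4 >= t ^ 2 / 4].  The fourth one
    is no smaller, so both are far elements. *)
Lemma in_phase_next t n a B : (1 < t)%N -> (t <= n.+2)%N -> 0 <= a ->
  B <= t%:R ^+ 2 / 4 -> a + n.+2%:R / 2 + 1 <= B ->
  in_phase t n a B -> in_phase t n.+4 (a + n.+2%:R / 2) B.
Proof.
move=> t1 tn a0 Bt cB ph; have n2 : 0 <= n.+2%:R :> R by [].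
have aB : a + 1 <= B by lra.
have [yn2 Mn2 yn3] := in_phase_start t1 tn ph aB.
have n2' : 2 <= n.+2%:R :> R by rewrite ler_nat.
have tn' : t%:R ^+ 2 <= n.+2%:R ^+ 2 :> R.
  by rewrite lerXn2r ?nnegrE ?ler_nat.
case: ph => Mn Mn1 [lo [hi [gE loa hiB lohi]]].
set c := a + _ in cB yn2 yn3 *.
pose lo' := rcons (rcons lo a) (a + 1).
have lo'E l : lo' ++ l = lo ++ a :: a + 1 :: l by rewrite !cat_rcons.
have ac : a + 1 <= c by rewrite /c; lra.
have lo'c : all (<= c) lo'.
  rewrite !all_rcons /= ac /=; apply/andP; split; first by lra.
  by apply: sub_all loa => z /= za; lra.
have lo'cE l : lo' ++ c :: c + 1 :: l = rcons (rcons lo' c) (c + 1) ++ l.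
  by rewrite !cat_rcons.
have g2 : perm_eq (nf_gamma R t n.+2) (lo' ++ c :: hi).
  by rewrite (nf_gammaS R t1 tn) yn2; apply: perm_insert; rewrite lo'E.
have g3 : perm_eq (nf_gamma R t n.+3) (lo' ++ c :: c + 1 :: hi).
  rewrite (nf_gammaS R t1 (leqW tn)) yn3 lo'cE cat_rcons.
  by apply: perm_insert; rewrite cat_rcons.
have g4 : perm_eq (nf_gamma R t n.+4)
    (lo' ++ c :: c + 1 :: nf_orbit R t n.+4 :: hi).
  rewrite (nf_gammaS R t1 (leqW (leqW tn))) lo'cE.
  by apply: perm_insert; rewrite -lo'cE.
have g5 : perm_eq (nf_gamma R t n.+4.+1)
    (lo' ++ c :: c + 1 :: nf_orbit R t n.+4.+1 :: nf_orbit R t n.+4 :: hi).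
  rewrite (nf_gammaS R t1 (leqW (leqW (leqW tn)))) lo'cE.
  by apply: perm_insert; rewrite -lo'cE.
have hic x : x <= B -> all (>= x) hi.
  by move=> xB; apply: sub_all hiB => z; exact: le_trans.
have Mn3 : nf_median R t n.+3 = (a + 1 + c) / 2.
  rewrite (nf_medianE R (ltnW t1) (leqW (leqW tn))).
  rewrite (@median_even _ _ (rcons lo a) (c + 1 :: hi) (a + 1) c) //.
  - by rewrite -cat_rcons.
  - rewrite all_rcons /= lerDl ler01 /=.
    by apply: sub_all loa => z /= za; rewrite ler_wpDr.
  - by rewrite /= lerDl ler01 hic//; lra.
  - by rewrite size_rcons lohi.
have Bb : B <= nf_orbit R t n.+4.
  rewrite nf_orbitSS Mn3 Mn2 -[n.+4%:R]natr1 -[n.+3%:R]natr1 /c.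
  rewrite [leRHS](_ : _ = a + n.+2%:R ^+ 2 / 4); last by field.
  by lra.
have Mn4 : nf_median R t n.+4 = c.
  rewrite (nf_medianE R (ltnW t1) (leqW (leqW (leqW tn)))).
  rewrite (@median_odd _ _ lo' (c + 1 :: nf_orbit R t n.+4 :: hi) c) //.
  - by rewrite /= lerDl ler01 hic ?andbT /=; lra.
  - by rewrite !size_rcons lohi.
(* Here [N / 2 >= 1] absorbs the constant. *)
have Bb' : B <= nf_orbit R t n.+4.+1.
  rewrite nf_orbitSS Mn4 Mn3.
  rewrite -[n.+4.+1%:R]natr1 -[n.+4%:R]natr1 -[n.+3%:R]natr1 /c.
  rewrite [leRHS](_ : _ = a + n.+2%:R ^+ 2 / 4 + n.+2%:R / 2 - 1);
    last by field.
  by lra.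
have hiB' : all (>= B) [:: nf_orbit R t n.+4.+1, nf_orbit R t n.+4 & hi].
  by rewrite /= Bb' Bb.
split=> //; last first.
  exists lo', [:: nf_orbit R t n.+4.+1, nf_orbit R t n.+4 & hi]; split=> //.
  by rewrite !size_rcons lohi.
rewrite (nf_medianE R (ltnW t1) (leqW (leqW (leqW (leqW tn))))).
rewrite (median_even g5) //=; first by field.
- by rewrite lerDl.
- by apply: sub_all hiB' => z; exact: le_trans.
- by rewrite !size_rcons lohi.
Qed.

End Regular.

(** * The length of the regular phase *)

Section Length.
Variable R : realType.
Implicit Types (t l : nat).

(** Both sides say that the discriminant is smaller than
    [(t - l - 1) ^ 2]; when [t <= l + 1] both are false, since then
    [(t - l - 1) ^ 2 <= (l + 1) ^ 2], which is below the discriminant. *)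
Lemma u_lt l t :
  (u_ R l < t%:R) = (rung R t l.+1 + 1 < t%:R ^+ 2 / 4).
Proof.
pose x : R := t%:R - l.+1%:R; pose d : R := 5 * l%:R ^+ 2 + 6 * l%:R + 5.
have l0 : 0 <= l%:R :> R by [].
have t0 : 0 <= t%:R :> R by [].
have dE : t%:R ^+ 2 / 4 - (rung R t l.+1 + 1) = (x ^+ 2 - d) / 4.
  by rewrite /rung /x /d -natr1; field.
have -> : (rung R t l.+1 + 1 < t%:R ^+ 2 / 4) = (d < x ^+ 2).
  by apply/idP/idP => ?; lra.
rewrite /u_ -ltrBrDl -/x -/d; have [x0|x0] := ltP 0 x.
  by rewrite -{1}(gtr0_norm x0) -sqrtr_sqr ltr_sqrt ?exprn_gt0.
have xl : - (l%:R + 1) <= x by rewrite /x -natr1; lra.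
have -> : (d < x ^+ 2) = false.
  apply/negbTE; rewrite -leNgt /d.
  have : x ^+ 2 <= (l%:R + 1) ^+ 2 by rewrite -sqrrN lerXn2r ?nnegrE; lra.
  have : 0 <= l%:R ^+ 2 :> R by rewrite sqr_ge0.
  have -> : (l%:R + 1) ^+ 2 = l%:R ^+ 2 + 2 * l%:R + 1 :> R by ring.
  by lra.
apply/negbTE; rewrite -leNgt; apply: le_trans x0 _; exact: sqrtr_ge0.
Qed.

Lemma L_bounds t : (5 <= t)%N ->
  rung R t (L_ R t).+1 + 1 < t%:R ^+ 2 / 4 <= rung R t (L_ R t).+2 + 1.
Proof.
move=> t5; have [ut uMax] := L_max R t5; rewrite -u_lt ut leNgt -u_lt /=.
by apply/negP => /uMax; rewrite ltnn.
Qed.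

Lemma limit_boundE t : limit_bound R t = rung R t (L_ R t).+1 + 1.
Proof. by rewrite /limit_bound /rung -natr1; field. Qed.

Lemma in_phase_until_L t j : (5 <= t)%N -> (j <= (L_ R t).+1)%N ->
  in_phase t (t + 4 * j).-2 (rung R t j) (t%:R ^+ 2 / 4).
Proof.
move=> t5; have t1 : (1 < t)%N by lia.
elim: j => [_|j IH jL].
  rewrite muln0 addn0 (_ : rung R t 0 = 0); last by rewrite /rung !mul0r addr0.
  have e : t.-2.+1 = t.-1 by lia.
  split; rewrite ?e ?nf_gamma0 ?nf_median0 ?nf_median1 ?add0r ?div1r//; try lia.
  by exists [::], [::].
have [n nE] : exists n, (t + 4 * j = n.+2)%N by exists (t + 4 * j).-2; lia.
have -> : (t + 4 * j.+1).-2 = n.+4 by lia.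
move: IH; rewrite rungS nE /= => IH.
apply: in_phase_next => //; try lia; last exact/IH/ltnW.
  exact: rung_ge0.
have /andP[/ltW + _] := L_bounds t5; apply: le_trans; rewrite lerD2r.
by rewrite -nE -rungS; apply: rung_nondecreasing.
Qed.

(** The increments of the median at [N_t] and [N_t + 1] are both [1 / 2], so
    the corresponding terms of the orbit differ by [1 / 2 + 1 / 2]. *)
Lemma after_phase t : (5 <= t)%N ->
  nf_median R t (N_ R t).+1 = limit_bound R t /\
  nf_orbit R t (N_ R t).+2 = nf_orbit R t (N_ R t).+1 + 1.
Proof.
move=> t5; have := in_phase_until_L t5 (leqnn _).
have -> : (t + 4 * (L_ R t).+1).-2 = (N_ R t).-1 by rewrite /N_; lia.
have [n nE] : exists n, N_ R t = n.+1 by rewrite /N_ addnS; eexists.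
have tn : (t <= n.+2)%N by move: nE; rewrite /N_; lia.
rewrite nE /= limit_boundE => ph; have /andP[/ltW aB _] := L_bounds t5.
have t1 : (1 < t)%N by lia.
by have [-> -> ->] := in_phase_start t1 tn ph aB.
Qed.

Lemma limit_bound_le t : (5 <= t)%N ->
  ((limit_bound R t)%:E <= nf_limit R t)%E.
Proof.
move=> t5; have t1 : (1 < t)%N by lia.
rewrite /nf_limit (cvg_lim _ (ereal_nondecreasing_cvgn _))//; last first.
  by move=> m n mn; rewrite lee_fin; apply: nf_median_nondecreasing.
rewrite -(after_phase t5).1; apply: ereal_sup_ubound.
by exists (N_ R t).+1.
Qed.

Lemma transit_bound_le t : (5 <= t)%N ->
  ((transit_bound R t)%:E <= transit_time R t)%E.
Proof.
move=> t5; rewrite /transit_time /transit_bound.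
case: pselect => [ex|_]; last exact: leey.
rewrite lee_fin -natrD ler_nat addn2.
case: ex_minnP => m /asboolP[_ st] _; rewrite ltnNge; apply/negP => mN.
have e k : (m <= k)%N -> nf_orbit R t k = nf_orbit R t m.
  by move=> mk; rewrite -(subnKC mk) st.
have := (after_phase t5).2; rewrite !e ?(leqW mN) // => /eqP.
by rewrite -subr_eq0 opprD addNKr oppr_eq0 oner_eq0.
Qed.

End Length.

(** * Asymptotics of the bounds *)

Section Asymptotics.
Variable R : realType.
Implicit Types (t : nat).

(** An error that is smaller than [g] by a factor [O(1 / t)] is negligible. *)
Lemma equiv_of_error (f g : nat -> R) (C : R) (D : set nat) :
  (forall t, (5 <= t)%N -> t%:R * `|f t - g t| <= C * `|g t|) ->
  f ~_(within D \oo) g.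
Proof.
move=> fg; apply/eqaddoP => e e0; apply: cvg_within.
near=> t.
have t5 : (5 <= t)%N by near: t; exact: nbhs_infty_ge.
have tC : C / e <= t%:R by near: t; exact: nbhs_infty_ger.
have t0 : 0 < t%:R :> R by rewrite ltr0n; lia.
rewrite -(ler_pM2l t0) (le_trans (fg t t5)) // mulrA ler_wpM2r //.
by rewrite -ler_pdivrMr.
Unshelve. all: by end_near. Qed.

Lemma L_lt t : (5 <= t)%N -> (L_ R t < t)%N.
Proof.
move=> t5; have [ut _] := L_max R t5.
by rewrite -(ltr_nat R); apply: lt_trans (lt_u_ R _) ut.
Qed.

Lemma limit_bound_equiv (D : set nat) :
  limit_bound R ~_(within D \oo) (fun t : nat => t%:R ^+ 2 / 4 : R).
Proof.
apply: (@equiv_of_error _ _ 20) => t t5.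
have /andP[lo hi] := L_bounds R t5.
have tL : (L_ R t)%:R <= t%:R :> R by rewrite ler_nat ltnW // L_lt.
have t5' : 5 <= t%:R :> R by rewrite (ler_nat R 5 t).
move: hi; rewrite rungS natrD natrM -[(L_ R t).+1%:R]natr1 => hi.
rewrite limit_boundE ltr0_norm; last by lra.
rewrite ger0_norm; last by rewrite divr_ge0 ?sqr_ge0.
have -> : 20 * (t%:R ^+ 2 / 4) = t%:R * (5 * t%:R) :> R by field.
by rewrite ler_wpM2l//; lra.
Qed.

(** The two inequalities that determine [L] say that [(t + 4 L) ^ 2] differs
    from [5 t ^ 2] by [O(t)], so the square roots differ by [O(1)]. *)
Lemma transit_bound_equiv (D : set nat) :
  transit_bound R ~_(within D \oo) (fun t : nat => t%:R * Num.sqrt 5 : R).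
Proof.
apply: (@equiv_of_error _ _ 80) => t t5.
have /andP[lo hi] := L_bounds R t5.
have tL : (L_ R t)%:R <= t%:R :> R by rewrite ler_nat ltnW // L_lt.
have t5' : 5 <= t%:R :> R by rewrite (ler_nat R 5 t).
have s5 : Num.sqrt 5 ^+ 2 = 5 :> R by rewrite sqr_sqrtr.
have s0 : 0 <= Num.sqrt 5 :> R by rewrite sqrtr_ge0.
have s1 : 1 <= Num.sqrt 5 :> R by nra.
rewrite /transit_bound /N_ 2!natrD natrM.
move: lo hi; rewrite /rung -[(L_ R t).+2%:R]natr1 -[(L_ R t).+1%:R]natr1.
set s := Num.sqrt 5 in s5 s0 s1 *; set l := (L_ R t)%:R in tL *.
set T := t%:R in tL t5' *.
have l0 : 0 <= l by rewrite /l.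
move=> lo hi.
pose q := T ^+ 2 - 2 * T * l - 4 * l ^+ 2; pose d := T * s - (T + 4 * l).
have dq : d * (T * s + (T + 4 * l)) = 4 * q.
  by rewrite -subr_sqr exprMn s5 /q; ring.
have q0 : 0 < q by rewrite /q; lra.
have qT : 4 * q <= 74 * T by rewrite /q; lra.
have Ts : 0 <= T * s by rewrite mulr_ge0 //; lra.
have d0 : 0 <= d.
  by rewrite -(@pmulr_lge0 _ (T * s + (T + 4 * l))) ?dq; lra.
have d74 : d <= 74.
  have : d * T <= 74 * T.
    by apply: le_trans qT; rewrite -dq ler_wpM2l //; lra.
  by rewrite ler_pM2r //; lra.
rewrite [X in 80 * X]ger0_norm // mulrCA ler_wpM2l //.
rewrite (_ : _ - _ = 5 - d); last by rewrite /d; ring.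
by apply: (@le_trans _ _ 80); [rewrite ler_norml; lra | lra].
Qed.

End Asymptotics.

Theorem theorem19 (R : realType) :
  (forall t : nat, (5 <= t)%N -> odd t ->
     ((limit_bound R t)%:E <= nf_limit R t)%E /\
     ((transit_bound R t)%:E <= transit_time R t)%E) /\
  limit_bound R ~_(within [set t : nat | odd t] \oo)
    (fun t : nat => t%:R ^+ 2 / 4 : R) /\
  transit_bound R ~_(within [set t : nat | odd t] \oo)
    (fun t : nat => t%:R * Num.sqrt 5 : R).
Proof.
split; last by split; [exact: limit_bound_equiv | exact: transit_bound_equiv].
by move=> t t5 _; split; [exact: limit_bound_le | exact: transit_bound_le].
Qed.
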